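(* Let $(S,+)$ be a Clifford semigroup. Let $\mathbb{WB}^+$ be the set of all weak left braces $(S,+,\cdot)$ with the given addition $+$, and let $\mathbb{GIS}$ be the set of all good inverse subsemigroups of $\mathrm{End}(S,+)\rtimes(S,+)$. For $(S,+,\cdot)\in\mathbb{WB}^+$ let $\mathcal{S}(S)=\{(\lambda_a,a)\mid a\in S\}$, where $\lambda_a(b)=-a+ab$. For $H\in\mathbb{GIS}$ let $\mathcal{B}(H)=(S,+,\circ)$, where $a\circ b=a+f(b)$ with $(f,a)$ the unique element of $H$ whose second component is $a$. Then $\mathcal{S}:\mathbb{WB}^+\to\mathbb{GIS}$ and $\mathcal{B}:\mathbb{GIS}\to\mathbb{WB}^+$ are mutually inverse bijections, under which dual weak left braces correspond to good Clifford subsemigroups. Moreover, if $(S,+)$ has an identity $0$, then isomorphic weak left brace structures in $\mathbb{WB}^+$ correspond to conjugate inverse subsemigroups of $\mathrm{End}(S,+)\rtimes(S,+)$: two weak left braces in $\mathbb{WB}^+$ are isomorphic if and only if the corresponding good inverse subsemigroups $H,K$ satisfy $(\psi,0)H(\psi^{-1},0)=K$ for some $\psi\in\mathrm{Aut}(S,+)$.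
   Context: A semigroup $(S,+)$ (not necessarily commutative) is an inverse semigroup if for each $a\in S$ there is a unique element $-a$ with $a-a+a=a$ and $-a+a-a=-a$; for an inverse semigroup $(S,\cdot)$ written multiplicatively this element is written $a^{-1}$. An inverse semigroup $(S,+)$ is a Clifford semigroup if $-a+a=a-a$ for all $a$. A subsemigroup is an inverse (Clifford) subsemigroup if it is an inverse (Clifford) semigroup under the restricted operation. $\mathrm{End}(S,+)$ is the semigroup of semigroup endomorphisms of $(S,+)$ under composition $fg=f\circ g$, and $\mathrm{Aut}(S,+)$ is the group of semigroup automorphisms. A weak left brace is a triple $(S,+,\cdot)$ with $(S,+)$ and $(S,\cdot)$ inverse semigroups such that $x(y+z)=xy-x+xz$ and $xx^{-1}=-x+x$ for all $x,y,z\in S$. It is a dual weak left brace if moreover $(S,\cdot)$ is a Clifford semigroup. An isomorphism of weak left braces is a bijection preserving both operations. $\mathrm{End}(S,+)\rtimes(S,+)$ is the set $\mathrm{End}(S,+)\times S$ with the associative multiplication $(f,x)(g,y)=(fg,\,x+f(y))$. An inverse (respectively Clifford) subsemigroup $H$ of it is called good if: (G1) $H\to S$, $(f,x)\mapsto x$, is a bijection; (G2) if $(f,x)\in H$ and $(f,x)^{-1}=(g,y)$ (inverse in $H$), then $(f,f(-y))\in H$; (G3) if $(f,x)\in H$, then $-x+x+f(y)=f(y)$ for all $y\in S$; (G4) if $(S,+)$ has an identity $0$, then $f(0)=-x+x$ for all $(f,x)\in H$. *)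

(* Defs.v *)
From HB Require Import structures.
From mathcomp Require Import all_boot.
From mathcomp Require Import boolp classical_sets functions.

Set Implicit Arguments.
Unset Strict Implicit.
Unset Printing Implicit Defensive.

Local Open Scope classical_set_scope.

(* The additive structures of MathComp are commutative, so the possibly
   noncommutative additive semigroup (S, +) is a [semigroupType], whose
   operation [mul] is written additively here. *)
Declare Scope addsemigroup_scope.
Delimit Scope addsemigroup_scope with A.
Notation "x + y" := (@mul _ x y) : addsemigroup_scope.

Section InverseSemigroups.
Context {T : choiceType}.
Implicit Types (op : T -> T -> T) (A : set T).

Definition is_inverse op A (x y : T) : Prop :=
  [/\ A y, op (op x y) x = x & op (op y x) y = y].

Definition has_unique_inverses op A : Prop :=
  forall x, A x -> exists! y, is_inverse op A x y.

(* The value is junk (x itself) if x has no inverse in A. *)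
Definition inverse op A (x : T) : T := xget x [set y | is_inverse op A x y].

Definition inverses_commute op A : Prop :=
  forall x, A x -> op (inverse op A x) x = op x (inverse op A x).

Definition inverse_semigroup op : Prop :=
  associative op /\ has_unique_inverses op [set: T].

Definition clifford_semigroup op : Prop :=
  inverse_semigroup op /\ inverses_commute op [set: T].

End InverseSemigroups.

Definition inverse_subsemigroup (G : semigroupType) (H : set G) : Prop :=
  (forall x y, H x -> H y -> H (x * y)%g) /\ has_unique_inverses (@mul G) H.

Definition clifford_subsemigroup (G : semigroupType) (H : set G) : Prop :=
  inverse_subsemigroup H /\ inverses_commute (@mul G) H.

Definition neg (S : semigroupType) (x : S) : S := inverse (@mul S) [set: S] x.
Notation "- x" := (neg x) : addsemigroup_scope.
Notation "x - y" := (@mul _ x (neg y)) : addsemigroup_scope.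

Definition is_identity (S : semigroupType) (e : S) : Prop :=
  left_id e (@mul S) /\ right_id e (@mul S).

HB.instance Definition _ (S : semigroupType) :=
  gen_eqMixin {multiplicative S -> S}.
HB.instance Definition _ (S : semigroupType) :=
  gen_choiceMixin {multiplicative S -> S}.

Lemma endo_eqP (S : semigroupType) (f g : {multiplicative S -> S}) :
  f =1 g -> f = g.
Proof.
case: f g => [f [[fM]]] [g [[gM]]] /= /funext fg.
by case: _ / fg gM => gM; rewrite (Prop_irrelevance fM gM).
Qed.

(* End(S, +) >< (S, +).  An alias, so as not to get the componentwise
   multiplication of the product type. *)
Definition sdprod (S : semigroupType) : Type :=
  ({multiplicative S -> S} * S)%type.

HB.instance Definition _ (S : semigroupType) := Choice.on (sdprod S).

Section SemidirectProduct.
Variable S : semigroupType.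
Local Open Scope addsemigroup_scope.

Definition sdpair (f : {multiplicative S -> S}) (x : S) : sdprod S := (f, x).

Definition sdmul (p q : sdprod S) : sdprod S :=
  sdpair (p.1 \o q.1) (p.2 + p.1 q.2).

Lemma sdmulA : associative sdmul.
Proof.
move=> [f x] [g y] [h z]; congr pair => /=; first exact: endo_eqP.
by rewrite gmulfM mulgA.
Qed.

HB.instance Definition _ := isSemigroup.Build (sdprod S) sdmulA.

Definition good (H : set (sdprod S)) : Prop :=
  [/\ set_bij H [set: S] snd,
      forall f x g y, H (sdpair f x) ->
        inverse (@mul (sdprod S)) H (sdpair f x) = sdpair g y ->
        H (sdpair f (f (- y))),
      forall f x, H (sdpair f x) -> forall y, - x + x + f y = f y &
      forall e, is_identity e ->
        forall f x, H (sdpair f x) -> f e = - x + x].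

Definition GIS : set (set (sdprod S)) :=
  [set H | inverse_subsemigroup H /\ good H].

Definition GCS : set (set (sdprod S)) :=
  [set H | clifford_subsemigroup H /\ good H].

End SemidirectProduct.

Section WeakLeftBraces.
Variable S : semigroupType.
Local Open Scope addsemigroup_scope.
Implicit Type m : S -> S -> S.

Definition weak_left_brace m : Prop :=
  [/\ inverse_semigroup (@mul S), inverse_semigroup m,
      forall x y z, m x (y + z) = m x y - x + m x z &
      forall x, m x (inverse m [set: S] x) = - x + x].

Definition dual_weak_left_brace m : Prop :=
  weak_left_brace m /\ clifford_semigroup m.

Definition WB : set (S -> S -> S) := [set m | weak_left_brace m].

Definition DWB : set (S -> S -> S) := [set m | dual_weak_left_brace m].

Definition wlb_isomorphic (m1 m2 : S -> S -> S) : Prop :=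
  exists psi : S -> S,
    [/\ bijective psi, {morph psi : x y / x + y} &
        forall x y, psi (m1 x y) = m2 (psi x) (psi y)].

Definition lambda m (a b : S) : S := - a + m a b.

(* The set of the pairs (lambda_a, a); that every lambda_a is an endomorphism,
   hence is the first component of such a pair, is not built in: it is part of
   [set_bij (calS m) setT snd] in [good (calS m)]. *)
Definition calS m : set (sdprod S) := [set p : sdprod S | p.1 =1 lambda m p.2].

(* The endomorphism f with (f, a) in H; junk (the identity) if there is none. *)
Definition endo_at (H : set (sdprod S)) (a : S) : {multiplicative S -> S} :=
  xget (idfun : {multiplicative S -> S}) [set f | H (sdpair f a)].

Definition calB (H : set (sdprod S)) : S -> S -> S :=
  fun a b => a + endo_at H a b.

End WeakLeftBraces.

(* Main.v *)
Require Import Defs.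
From HB Require Import structures.
From mathcomp Require Import all_boot.
From mathcomp Require Import boolp classical_sets functions.

Local Open Scope classical_set_scope.

(* The second projection is an isomorphism from the semidirect-product side onto
   (S, .): a + lambda_a(b) = ab and lambda_(ab) = lambda_a lambda_b, the first
   because additive idempotents are central.  Hence inverses, and the Clifford
   condition, can be read off on either side.  The one axiom that does not
   transfer formally is x x^-1 = -x + x for the operation built from a good H:
   it amounts to f(-y) = x when (g, y) is the inverse of (f, x) in H, and
   follows from (G2) and the commutation of idempotents in H. *)

Lemma cancel_in_set_bij (T U : Type) (A : set T) (B : set U)
    (f : T -> U) (g : U -> T) :
  (forall x, A x -> B (f x)) -> (forall y, B y -> A (g y)) ->
  {in A, cancel f g} -> {in B, cancel g f} -> set_bij A B f.
Proof.
move=> fAB gBA fK gK; split => //.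
- by move=> x y xA yA fxy; rewrite -(fK x) // fxy fK.
- by move=> y By; exists (g y); [exact: gBA | rewrite gK ?inE].
Qed.

(** * Uniqueness of inverses and commuting idempotents *)

Section InverseSemigroupTheory.
Context {T : choiceType} (op : T -> T -> T) (A : set T).
Hypotheses (opA : associative op) (invA : has_unique_inverses op A).

Lemma inverseP x : A x -> is_inverse op A x (inverse op A x).
Proof. by move=> /invA[y [xy _]]; apply: xgetPex; exists y. Qed.

Lemma inverse_eq x y : A x -> is_inverse op A x y -> inverse op A x = y.
Proof.
move=> Ax xy; have [z [_ uniq_z]] := invA x Ax.
by rewrite -(uniq_z _ xy) -(uniq_z _ (inverseP x Ax)).
Qed.

Lemma is_inverse_uniq x y z :
  A x -> is_inverse op A x y -> is_inverse op A x z -> y = z.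
Proof. by move=> Ax xy xz; rewrite -(inverse_eq x y) // (inverse_eq x z). Qed.

Hypothesis closedA : forall x y, A x -> A y -> A (op x y).

(* If x is the inverse of ef then so is fxe; hence x = fxe, which makes x
   idempotent and its own inverse, so that ef = x. *)
Lemma mul_idempotents e f : A e -> A f -> op e e = e -> op f f = f ->
  op (op e f) (op e f) = op e f.
Proof.
move=> Ae Af ee ff; have Aef := closedA e f Ae Af.
set x := inverse op A (op e f).
have [Ax x1 x2] : is_inverse op A (op e f) x by apply: inverseP.
have fxe : x = op (op f x) e.
  apply: (is_inverse_uniq (op e f)) => //; split.
  - exact: (closedA _ _ (closedA _ _ Af Ax) Ae).
  - by rewrite -[RHS]x1 -!opA (opA f f) ff (opA e e) ee.
  - by rewrite -[in RHS]x2 -!opA (opA e e) ee (opA f f) ff.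
have xx : op x x = x.
  by rewrite [in LHS]fxe [in RHS]fxe -[in RHS]x2 -!opA.
have -> : op e f = x; last by [].
apply: (is_inverse_uniq x) => //; split => //; by rewrite xx.
Qed.

(** Both products are idempotent, so each of them is an inverse of [op e f]; uniqueness of inverses
    identifies them. *)
Lemma idempotents_commute e f : A e -> A f -> op e e = e -> op f f = f ->
  op e f = op f e.
Proof.
move=> Ae Af ee ff.
have ef2 := mul_idempotents e f Ae Af ee ff.
have fe2 := mul_idempotents f e Af Ae ff ee.
apply: (is_inverse_uniq (op e f)); first exact: closedA.
- by split; [exact: closedA | rewrite !ef2..].
- split; first exact: closedA.
  + by rewrite -!opA (opA f f) ff (opA e e) ee opA ef2.
  + by rewrite -!opA (opA e e) ee (opA f f) ff opA fe2.
Qed.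

End InverseSemigroupTheory.

(** * Inverses along a multiplicative bijection from a closed subset onto a whole type *)

Section TransportOfInverses.
Context {T U : choiceType} (opT : T -> T -> T) (opU : U -> U -> U).
Context (A : set T) (phi : T -> U).
Hypothesis phi_bij : set_bij A [set: U] phi.
Hypothesis closedA : forall x y, A x -> A y -> A (opT x y).
Hypothesis phiM :
  forall x y, A x -> A y -> phi (opT x y) = opU (phi x) (phi y).

Let phi_inj x y : A x -> A y -> phi x = phi y -> x = y.
Proof. by case: phi_bij => _ inj _ Ax Ay; apply: inj; rewrite inE. Qed.

Let phi_surj u : exists2 x, A x & phi x = u.
Proof. by case: phi_bij => _ _ /(_ u I). Qed.

Lemma is_inverse_bij x y : A x -> A y ->
  is_inverse opT A x y <-> is_inverse opU [set: U] (phi x) (phi y).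
Proof.
move=> Ax Ay; have Axy := closedA x y Ax Ay; have Ayx := closedA y x Ay Ax.
split=> -[_ xyx yxy]; split => //; rewrite -?phiM ?xyx ?yxy //.
- by apply: phi_inj; [exact: closedA | | rewrite !phiM].
- by apply: phi_inj; [exact: closedA | | rewrite !phiM].
Qed.

Lemma has_unique_inverses_bij :
  has_unique_inverses opT A <-> has_unique_inverses opU [set: U].
Proof.
split=> inv => [u _ | x Ax].
  have [x Ax <-] := phi_surj u; have [y [xy uniq_y]] := inv x Ax.
  have Ay : A y by case: xy.
  exists (phi y); split; first exact/is_inverse_bij.
  move=> v; have [z Az <-] := phi_surj v.
  by move=> /is_inverse_bij xz; rewrite (uniq_y z) //; apply: xz.
have [v [xv uniq_v]] := inv (phi x) I; have [y Ay yv] := phi_surj v.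
exists y; split; first by apply/is_inverse_bij; rewrite ?yv.
move=> z xz; have Az : A z by case: xz.
by apply: phi_inj => //; rewrite yv; apply: uniq_v; apply/is_inverse_bij.
Qed.

Hypothesis invA : has_unique_inverses opT A.

Lemma inverse_bij x : A x ->
  phi (inverse opT A x) = inverse opU [set: U] (phi x).
Proof.
move=> Ax; have xy := inverseP _ _ invA x Ax; have [Ay _ _] := xy.
apply/esym/inverse_eq => //; first exact/has_unique_inverses_bij.
exact/is_inverse_bij.
Qed.

Lemma inverses_commute_bij :
  inverses_commute opT A <-> inverses_commute opU [set: U].
Proof.
split=> comm => [u _ | x Ax].
  have [x Ax <-] := phi_surj u; have [Ay _ _] := inverseP _ _ invA x Ax.
  by rewrite -inverse_bij // -!phiM // comm.
have [Ay _ _] := inverseP _ _ invA x Ax.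
apply: phi_inj; [exact: closedA.. | by rewrite !phiM // inverse_bij // comm].
Qed.

End TransportOfInverses.

(** * Clifford addition: negation, central idempotents and the maps [lambda] *)

Section CliffordAddition.
Variable S : semigroupType.
Hypothesis S_clifford : clifford_semigroup (@mul S).
Local Open Scope addsemigroup_scope.

Let addA : associative (@mul S) := mulgA.

Let invS : has_unique_inverses (@mul S) [set: S].
Proof. by case: S_clifford => -[]. Qed.

Lemma addrNr (x : S) : x - x + x = x.
Proof. by case: (inverseP _ _ invS x I). Qed.

Lemma addNrN (x : S) : - x + x - x = - x.
Proof. by case: (inverseP _ _ invS x I). Qed.

Lemma addNC (x : S) : - x + x = x - x.
Proof. by case: S_clifford => _ /(_ x I). Qed.

Lemma addr_idemr (x : S) : x + (- x + x) = x.
Proof. by rewrite addA addrNr. Qed.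

Lemma neg_eq (x y : S) : x + y + x = x -> y + x + y = y -> - x = y.
Proof. by move=> xyx yxy; apply: inverse_eq. Qed.

Lemma negK (x : S) : - - x = x.
Proof. by apply: neg_eq; rewrite ?addNrN ?addrNr. Qed.

Lemma endoN (f : {multiplicative S -> S}) (x : S) : f (- x) = - f x.
Proof.
by apply/esym/neg_eq; rewrite -!gmulfM; [rewrite addrNr | rewrite addNrN].
Qed.

Lemma idem_neg (x : S) : - x + x + (- x + x) = - x + x.
Proof. by rewrite addA addNrN. Qed.

Lemma idem_addC (e f : S) : e + e = e -> f + f = f -> e + f = f + e.
Proof. by move=> ee ff; apply: (idempotents_commute _ [set: S]). Qed.

(* e commutes with x - x, so -(e + x) = -x + e; the Clifford condition for e + x
   then reads -x + (e + x) = x + (-x + e). *)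
Lemma idem_central (e x : S) : e + e = e -> e + x = x + e.
Proof.
move=> ee; have xx : x - x + (x - x) = x - x by rewrite -addNC idem_neg.
have ex z : e + (x + (- x + z)) = x + (- x + (e + z)).
  by rewrite !addA -(addA e) (idem_addC _ _ ee xx).
have Nex : - (e + x) = - x + e.
  apply: neg_eq; rewrite -!addA (addA e e) ee.
    by rewrite ex (addA e e) ee -ex addr_idemr.
  by rewrite ex ee !addA addNrN.
have := addNC (e + x); rewrite Nex -!addA ex ee (addA e e) ee => exe.
by rewrite -[in LHS](addr_idemr x) ex exe [in LHS](addA _ (- x)) -addNC addA
           addr_idemr.
Qed.

(** The idempotents [- x + x] and [y - y] commute, which makes [- y - x] an inverse of [x + y]. *)
Lemma negD (x y : S) : - (x + y) = - y - x.
Proof.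
have xx := idem_neg x; have yy := idem_neg y; rewrite addNC in yy.
apply: neg_eq.
- transitivity (x + ((y - y) + ((- x + x) + y))); first by rewrite !addA.
  by rewrite (addA (y - y)) (idem_addC _ _ yy xx) -addA addrNr addA addr_idemr.
- transitivity (- y + ((- x + x) + ((y - y) - x))); first by rewrite !addA.
  rewrite (addA (- x + x)) (idem_addC _ _ xx yy) !addA addNrN.
  by rewrite -!addA (addA (- x)) addNrN.
Qed.

(** The point is that [a - a] fixes [m a b] on the left. Expanding [b = b - b + b] by the brace law
    gives [m a b = m a (b - b) + (- a + m a b)]; the central idempotent [a - a] moves past the first
    term and is absorbed by [- a]. *)
Lemma braceE (m : S -> S -> S) a b : weak_left_brace m ->
  m a b = a + lambda m a b.
Proof.
move=> [_ _ brace _].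
have aa : a - a + (a - a) = a - a by rewrite -addNC idem_neg.
have mab : m a b = m a (b - b) + (- a + m a b) by rewrite addA -brace addrNr.
rewrite /lambda [in RHS]mab (addA a) (addA (a - a)) (idem_central _ _ aa) -addA.
by rewrite -(addNC a) (addA (- a + a)) addNrN -mab.
Qed.

Lemma lambdaD (m : S -> S -> S) a : weak_left_brace m ->
  {morph lambda m a : x y / x + y}.
Proof. by move=> [_ _ brace _] x y; rewrite /lambda brace !addA. Qed.

Definition lambda_endo (m : S -> S -> S) (wm : weak_left_brace m) a :
    {multiplicative S -> S} :=
  HB.pack (lambda m a) (isMultiplicative.Build S S _ (lambdaD m a wm)).

(** The brace law turns the right side into [lambda m a (- b) - a + m a (m b c)], whose first two
    terms are [- lambda m a b - a = - (a + lambda m a b) = - m a b]. *)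
Lemma lambdaM (m : S -> S -> S) a b c : weak_left_brace m ->
  lambda m (m a b) c = lambda m a (lambda m b c).
Proof.
move=> wm; have [_ [mA _] brace _] := wm.
have lN : lambda m a (- b) = - lambda m a b := endoN (lambda_endo m wm a) b.
rewrite [in RHS]/lambda brace !addA -/(lambda m a (- b)) lN -negD -braceE //.
by rewrite /lambda mA.
Qed.

(** * From a weak left brace to a good inverse subsemigroup *)

Section BraceToSubsemigroup.
Variable m : S -> S -> S.
Hypothesis wm : weak_left_brace m.

Let invm : has_unique_inverses m [set: S]. Proof. by case: wm => _ []. Qed.

Lemma calS_closed p q : calS m p -> calS m q -> calS m (p * q)%g.
Proof.
case: p q => [f a] [g b] /= fa gb c /=.
by rewrite !fa gb /= -braceE // lambdaM.
Qed.

Lemma calS_bij : set_bij (calS m) [set: S] snd.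
Proof.
split=> //.
- move=> [f a] [g b]; rewrite !inE /= => fa gb ab; subst b.
  by congr pair; apply: endo_eqP => c; rewrite fa gb.
- by move=> a _; exists (sdpair (lambda_endo m wm a) a).
Qed.

Lemma calS_mul p q : calS m p -> calS m q -> (p * q)%g.2 = m p.2 q.2.
Proof. by case: p q => [f a] [g b] /= fa gb /=; rewrite fa -braceE. Qed.

Lemma calS_unique_inverses : has_unique_inverses (@mul (sdprod S)) (calS m).
Proof.
exact/(has_unique_inverses_bij _ m _ snd calS_bij calS_closed calS_mul).
Qed.

Lemma calS_GIS : GIS (calS m).
Proof.
split; first by split; [exact: calS_closed | exact: calS_unique_inverses].
have [_ _ _ mulV] := wm.
split; first exact: calS_bij.
(* (G2): [b] is the multiplicative inverse of [a], so [f b = - a + (- a + a) = - a]. Hence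
   [f (- b) = a], and the required pair is [(f, a)] itself. *)
- move=> f a g b fa fab c /=.
  have ab : b = inverse m [set: S] a.
    rewrite -(inverse_bij _ _ _ _ calS_bij calS_closed calS_mul
                calS_unique_inverses (sdpair f a)) //.
    by rewrite fab.
  by rewrite endoN (fa b) /= ab [lambda m a (inverse _ _ _)]/lambda mulV addNC
             addA addNrN negK fa.
- by move=> f a fa y; rewrite fa /lambda addA addNrN.
- move=> e [e0 e1] f a fa.
  (* (G4): as [- a] is a value of [f], it is fixed by adding [f e] on the left, so
     [f e - a + a = - a + a]. The central idempotent [- a + a] can also be moved to the left of
     [f e = - a + m a e], which absorbs it, so the same sum is [f e]. *)
  have la : - a = f (inverse m [set: S] a).
    by rewrite fa /lambda mulV addNC addA addNrN.
  rewrite -[RHS](_ : f e - a + a = _); last by rewrite [in LHS]la -gmulfM e0 -la.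
  by rewrite -addA -(idem_central _ _ (idem_neg a)) fa /lambda !addA addNrN.
Qed.

Lemma endo_at_calS a : endo_at (calS m) a =1 lambda m a.
Proof.
suff: calS m (sdpair (endo_at (calS m) a) a) by [].
by apply: (@xgetPex _ _ [set f | calS m (sdpair f a)]);
   exists (lambda_endo m wm a).
Qed.

Lemma calSK : calB (calS m) = m.
Proof.
by apply/funext => a; apply/funext => b; rewrite /calB endo_at_calS -braceE.
Qed.

Lemma calS_comm :
  inverses_commute (@mul (sdprod S)) (calS m) <-> inverses_commute m [set: S].
Proof.
exact: (inverses_commute_bij _ m _ snd calS_bij calS_closed calS_mul
          calS_unique_inverses).
Qed.

End BraceToSubsemigroup.

(** * From a good inverse subsemigroup to a weak left brace *)

Section SubsemigroupToBrace.
Variable H : set (sdprod S).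
Hypothesis gH : GIS H.

Let H_bij : set_bij H [set: S] snd. Proof. by case: gH => _ []. Qed.

Let H_closed p q : H p -> H q -> H (p * q)%g.
Proof. by case: gH => -[Hc _] _; apply: Hc. Qed.

Let invH : has_unique_inverses (@mul (sdprod S)) H.
Proof. by case: gH => -[]. Qed.

Let G3 f x y : H (sdpair f x) -> - x + x + f y = f y.
Proof. by case: gH => _ [_ _ G3 _] Hx; apply: G3 Hx _. Qed.

(** Surjectivity of the second projection rules out the default value of [endo_at]. *)
Lemma endo_atP a : H (sdpair (endo_at H a) a).
Proof.
case: H_bij => _ _ /(_ a I)[[f b] Hf /= ba]; subst b.
by apply: (@xgetPex _ _ [set f | H (sdpair f a)]); exists f.
Qed.

Lemma endo_at_eq f a : H (sdpair f a) -> endo_at H a = f.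
Proof.
move=> Hf; case: H_bij => _ inj _.
have: sdpair (endo_at H a) a = sdpair f a.
  by apply: inj; rewrite ?inE //; apply: endo_atP.
by case.
Qed.

Lemma calB_mul p q : H p -> H q -> (p * q)%g.2 = calB H p.2 q.2.
Proof. by case: p q => [f a] [g b] /= Hf Hg; rewrite /calB (endo_at_eq f). Qed.

Lemma calBA : associative (calB H).
Proof.
move=> a b c.
rewrite -(calB_mul _ _ (endo_atP b) (endo_atP c)).
rewrite -(calB_mul _ _ (endo_atP a) (H_closed _ _ (endo_atP b) (endo_atP c))).
rewrite mulgA.
rewrite (calB_mul _ _ (H_closed _ _ (endo_atP a) (endo_atP b)) (endo_atP c)).
by rewrite (calB_mul _ _ (endo_atP a) (endo_atP b)).
Qed.

Lemma calB_comm :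
  inverses_commute (@mul (sdprod S)) H <-> inverses_commute (calB H) [set: S].
Proof.
exact: (inverses_commute_bij _ (calB H) _ snd H_bij H_closed calB_mul invH).
Qed.

(** For the last equation, [f (g x)] is shown to be an additive inverse of [f y]: apply [f] to the
    second component of [(g, y)(f, x)(g, y) = (g, y)], apply [f \o g] to that of
    [(f, x)(g, y)(f, x) = (f, x)], and cancel with [fgf = f]. *)
Lemma is_inverse_sdprod f x g y :
    is_inverse (@mul (sdprod S)) H (sdpair f x) (sdpair g y) ->
  [/\ forall z, f (g (f z)) = f z, x + f y + f (g x) = x & f (g x) = - f y].
Proof.
case=> Hg [fgf xyx] [gfg yxy].
have fgf1 z : f (g (f z)) = f z by rewrite -[in RHS]fgf.
split => //; apply/esym/neg_eq.
- by rewrite -[in RHS]yxy !gmulfM fgf1.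
- by rewrite -[in RHS]xyx !gmulfM !fgf1.
Qed.

(* Put z = f (- y).  By (G2), (f, z) is in H; the idempotents that (f, x) and
   (f, z) form with their inverses are (fg, x - z) and (fh, z - z), and they
   commute, which forces fg = fh and x - z = z - z. *)
Lemma good_inverse f x g y : H (sdpair f x) ->
    is_inverse (@mul (sdprod S)) H (sdpair f x) (sdpair g y) ->
  f (- y) = x.
Proof.
move=> Hx xy; have [Hy xyx _] := xy.
have [fgf fx fgx] := is_inverse_sdprod _ _ _ _ xy.
rewrite endoN; set z := - f y in fgx *.
have Hz : H (sdpair f z).
  rewrite /z -endoN; case: gH => _ [_ G2 _ _].
  exact: G2 Hx (inverse_eq _ _ invH _ _ Hx xy).
case: (inverse _ _ _) (inverseP _ _ invH _ Hz) => h w zw.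
have [Hw zwz _] := zw; have [fhf _ fhz] := is_inverse_sdprod _ _ _ _ zw.
have fyz : f y = - z by rewrite negK.
have fgz : f (g z) = z by rewrite -fgx fgf.
have fwz : f w = - z by rewrite -[f w]negK -fhz -fgx fhf.
have := idempotents_commute _ _ mulgA invH H_closed _ _
  (H_closed _ _ Hx Hy) (H_closed _ _ Hz Hw).
rewrite !mulgA xyx zwz => /(_ erefl erefl) [fgfh].
have fgh t : f (g t) = f (h t).
  by have := congr1 (@^~ t) fgfh; rewrite /= fgf fhf.
rewrite /= fgf fhf fyz fgz fwz -fgh fgx addrNr -!addA (addA (- z)) addNrN => xz.
(* Now [x = x + f y + f (g x) = x - z + z = z - z + z = z]. *)
by rewrite -[RHS]fx fyz fgx xz addrNr.
Qed.

(** The brace law holds because (G3) absorbs the inner [- x + x] of [x + f y - x + x + f z]. For the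
    last axiom, [good_inverse] gives [f y = - x] when [(g, y)] is the inverse of [(f, x)], so the
    product is [x - x]. *)
Lemma calB_WB : WB (calB H).
Proof.
have H_inv := has_unique_inverses_bij _ _ _ _ H_bij H_closed calB_mul.
split; first by case: S_clifford.
- split; [exact: calBA | exact/H_inv].
- by move=> x y z;
     rewrite /calB gmulfM -!addA (addA (- x)) (G3 _ _ _ (endo_atP x)).
- move=> x.
  rewrite -(inverse_bij _ _ _ _ H_bij H_closed calB_mul invH _ (endo_atP x)).
  case: inverse (inverseP _ _ invH _ (endo_atP x)) => g y xy /=.
  by rewrite /calB -[endo_at H x y]negK -endoN
             (good_inverse _ _ _ _ (endo_atP x) xy) addNC.
Qed.

(** The map [lambda (calB H) a] is [- a + a] added to the values of [endo_at H a], and (G3) removes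
    this term. *)
Lemma calBK : calS (calB H) = H.
Proof.
apply/seteqP; split=> -[f a] /=.
- move=> fa; suff -> : f = endo_at H a by apply: endo_atP.
  apply: endo_eqP => b; rewrite fa /lambda /calB addA.
  exact: G3 (endo_atP a).
- by move=> Hf b; rewrite /lambda /calB (endo_at_eq f) //= addA (G3 f).
Qed.

End SubsemigroupToBrace.

(** * Isomorphism of braces and conjugacy of subsemigroups *)

Lemma wlb_isomorphicP (m1 m2 : S -> S -> S) :
  wlb_isomorphic m1 m2 <->
  exists psi psiV : {multiplicative S -> S},
    [/\ cancel psi psiV, cancel psiV psi &
        forall x y, psi (m1 x y) = m2 (psi x) (psi y)].
Proof.
split=> [[psi [[psiV psiK psiVK] psiD psiM]] | [psi [psiV [psiK psiVK psiM]]]].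
  (* Conjugation takes place in the semidirect product, so the inverse map must be a bundled
     endomorphism as well. *)
  have psiVD : {morph psiV : x y / x + y}.
    by move=> x y; apply: (canLR psiK); rewrite psiD !psiVK.
  pose f : {multiplicative S -> S} :=
    HB.pack psi (isMultiplicative.Build S S _ psiD).
  pose g : {multiplicative S -> S} :=
    HB.pack psiV (isMultiplicative.Build S S _ psiVD).
  by exists f, g.
exists psi; split=> //; [by exists psiV | exact: gmulfM].
Qed.

(** Conjugation sends [(f, a)] to a pair with first component [psi \o f \o psiV] and second
    component [psi (a + f e)], which is [psi a] since (G4) gives [f e = - a + a]. Equality of the
    two sets thus says that [psi] intertwines [lambda m1 a] with [lambda m2 (psi a)], which by
    [braceE] is multiplicativity of [psi]. *)
Lemma conj_calS (m1 m2 : S -> S -> S) e (psi psiV : {multiplicative S -> S}) :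
  is_identity e -> weak_left_brace m1 -> weak_left_brace m2 ->
  cancel psi psiV -> cancel psiV psi ->
  [set (sdpair psi e * h * sdpair psiV e)%g | h in calS m1] = calS m2 <->
  forall x y, psi (m1 x y) = m2 (psi x) (psi y).
Proof.
move=> eid wm1 wm2 psiK psiVK; have [e0 e1] := eid.
have conj2 p : calS m1 p ->
    (sdpair psi e * p * sdpair psiV e)%g.2 = psi p.2.
  case: p => f a m1f; have [_ [_ _ _ /(_ _ eid _ _ m1f) fe]] := calS_GIS m1 wm1.
  by rewrite /= e0 fe -gmulfM addr_idemr.
have psiVe : psiV e = e.
  by rewrite -[LHS]e0 -{1}(psiK e) -gmulfM e1 psiK.
have lambdaE x y : (forall x y, psi (m1 x y) = m2 (psi x) (psi y)) ->
    psi (lambda m1 x y) = lambda m2 (psi x) (psi y).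
  by move=> psiM; rewrite /lambda gmulfM endoN psiM.
split=> [conj x y | psiM].
- pose p := sdpair (lambda_endo m1 wm1 x) x.
  have m1p : calS m1 p by [].
  have : calS m2 (sdpair psi e * p * sdpair psiV e)%g by rewrite -conj; exists p.
  move=> /(_ (psi y)); rewrite conj2 // /= psiK => psil.
  by rewrite (braceE m2) // -psil -gmulfM -braceE.
- apply/seteqP; split=> [_ [p m1p <-] b | [g b] m2g].
    by rewrite conj2 //= m1p lambdaE // psiVK.
  pose p := sdpair (lambda_endo m1 wm1 (psiV b)) (psiV b).
  have m1p : calS m1 p by [].
  exists p => //; rewrite [LHS]surjective_pairing conj2 //= psiVK.
  by congr pair; apply: endo_eqP => c /=; rewrite lambdaE // !psiVK m2g.
Qed.

End CliffordAddition.

Theorem proposition3p7 (S : semigroupType)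
    (S_clifford : clifford_semigroup (@mul S)) :
  [/\ set_bij (@WB S) (@GIS S) (@calS S),
      set_bij (@GIS S) (@WB S) (@calB S),
      {in @WB S, cancel (@calS S) (@calB S)} &
      {in @GIS S, cancel (@calB S) (@calS S)}]
  /\ (set_bij (@DWB S) (@GCS S) (@calS S)
      /\ set_bij (@GCS S) (@DWB S) (@calB S))
  /\ (forall e : S, is_identity e ->
      forall m1 m2 : S -> S -> S, WB m1 -> WB m2 ->
      (wlb_isomorphic m1 m2 <->
       exists psi psiV : {multiplicative S -> S},
         [/\ cancel psi psiV, cancel psiV psi &
             [set (sdpair psi e * h * sdpair psiV e)%g | h in calS m1]
             = calS m2])).
Proof.
have SWB (m : S -> S -> S) : WB m -> GIS (calS m) := calS_GIS S S_clifford m.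
have BWB (H : set (sdprod S)) : GIS H -> WB (calB H) := calB_WB S S_clifford H.
have SK : {in @WB S, cancel (@calS S) (@calB S)}.
  by move=> m; rewrite inE; apply: calSK.
have BK : {in @GIS S, cancel (@calB S) (@calS S)}.
  by move=> H; rewrite inE; apply: calBK.
have SDWB (m : S -> S -> S) : DWB m -> GCS (calS m).
  case=> wm [_ mC]; have [invS gm] := SWB m wm.
  by split=> //; split=> //; apply/calS_comm.
have BDWB (H : set (sdprod S)) : GCS H -> DWB (calB H).
  case=> -[invH HC] gH; have wH := BWB H (conj invH gH).
  by split=> //; split; [case: wH | apply/calB_comm].
have DWB_sub (m : S -> S -> S) : m \in @DWB S -> m \in @WB S.
  by rewrite !inE => -[].
have GCS_sub (H : set (sdprod S)) : H \in @GCS S -> H \in @GIS S.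
  by rewrite !inE => -[[]].
(* The Clifford correspondences restrict the general ones and inherit their cancellation laws. *)
have SDK := sub_in1 DWB_sub SK; have BDK := sub_in1 GCS_sub BK.
split.
  by split; [exact: (cancel_in_set_bij _ _ _ _ _ _ SWB BWB SK BK)
           | exact: (cancel_in_set_bij _ _ _ _ _ _ BWB SWB BK SK) | |].
split.
  by split; [exact: (cancel_in_set_bij _ _ _ _ _ _ SDWB BDWB SDK BDK)
           | exact: (cancel_in_set_bij _ _ _ _ _ _ BDWB SDWB BDK SDK)].
move=> e eid m1 m2 wm1 wm2; rewrite wlb_isomorphicP.
split=> -[psi [psiV [psiK psiVK]]] psiM; exists psi, psiV; split=> //;
  exact/(conj_calS S S_clifford m1 m2 e psi psiV eid wm1 wm2 psiK psiVK).
Qed.
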